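(* For every median algebra $\mathbf{A}=\langle A,\mathbf{m}\rangle$, the following conditions are equivalent. (1) $\mathbf{A}$ is conservative. (2) $\mathbf{A}$ does not contain (an isomorphic copy of) the median algebra $\mathbf{A}_2$ as a subalgebra. (3) For every $a\in A$, the median semilattice $\langle A,\leq_a\rangle$ does not contain a copy of the poset $\mathbf{A}_2$.
   Context: A median algebra is a set $A$ with a ternary operation $\mathbf{m}$ satisfying $\mathbf{m}(x,x,y)=x$; $\mathbf{m}(x,y,z)=\mathbf{m}(y,x,z)=\mathbf{m}(y,z,x)$; and $\mathbf{m}(\mathbf{m}(x,y,z),t,u)=\mathbf{m}(x,\mathbf{m}(y,t,u),\mathbf{m}(z,t,u))$. It is conservative if $\mathbf{m}(x,y,z)\in\{x,y,z\}$ for all $x,y,z\in A$. For $a\in A$, the relation $\leq_a$ on $A$ is defined by $x\leq_a y \iff \mathbf{m}(a,x,y)=x$; it is a $\wedge$-semilattice order with bottom element $a$ and meet $x\wedge y=\mathbf{m}(a,x,y)$. Semilattices of this form are called median semilattices. Every median semilattice $\langle A,\leq\rangle$ carries the median operation $\mathbf{m}_\leq(x,y,z)=(x\wedge y)\vee(x\wedge z)\vee(z\wedge y)$ (these joins always exist), and $\mathbf{m}=\mathbf{m}_{\leq_a}$ for every $a\in A$. The poset $\mathbf{A}_2$ has four distinct elements $p,q,r,s$ with covering relations $p<q$, $q<r$, $q<s$ (so $p<q<r$, $p<q<s$, and $r,s$ are incomparable). It is a median semilattice; the median algebra $\mathbf{A}_2$ is $\{p,q,r,s\}$ with the median operation of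 this semilattice (in particular $\mathbf{m}(p,r,s)=q$). A poset contains a copy of another poset if the latter is isomorphic to a subset of the former with the induced order. *)

(* Defs.v *)
From mathcomp Require Import all_boot.
From Stdlib Require Import Relation_Operators.

Set Implicit Arguments.
Unset Strict Implicit.
Unset Printing Implicit Defensive.

Record medianAlgebra := MedianAlgebra {
  carrier :> Type;
  med : carrier -> carrier -> carrier -> carrier;
  med_xx : forall x y, med x x y = x;
  med_swap12 : forall x y z, med x y z = med y x z;
  med_swap23 : forall x y z, med y x z = med y z x;
  med_distr : forall x y z t u,
    med (med x y z) t u = med x (med y t u) (med z t u)
}.

Arguments med {m} x y z.

Definition conservative (A : medianAlgebra) : Prop :=
  forall x y z : A, [\/ med x y z = x, med x y z = y | med x y z = z].

Definition leq_at (A : medianAlgebra) (a x y : A) : Prop := med a x y = x.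

Definition subalgebra (A : medianAlgebra) (S : A -> Prop) : Prop :=
  forall x y z, S x -> S y -> S z -> S (med x y z).

Definition contains_subalgebra_copy (A B : medianAlgebra) : Prop :=
  exists S : A -> Prop, subalgebra S /\
  exists f : B -> A,
    [/\ injective f,
        forall y, S y <-> exists x, f x = y
      & forall x y z, f (med x y z) = med (f x) (f y) (f z)].

Definition contains_poset_copy (P Q : Type)
    (leP : P -> P -> Prop) (leQ : Q -> Q -> Prop) : Prop :=
  exists (S : P -> Prop) (f : Q -> P),
    [/\ injective f,
        forall y, S y <-> exists x, f x = y
      & forall x y, leQ x y <-> leP (f x) (f y)].

Inductive A2 : Type := A2_p | A2_q | A2_r | A2_s.

Definition A2_le (x y : A2) : bool :=
  match x, y with
  | A2_p, _ => true
  | A2_q, (A2_q | A2_r | A2_s) => true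
  | A2_r, A2_r | A2_s, A2_s => true
  | _, _ => false
  end.

Inductive A2_cover : A2 -> A2 -> Prop :=
  | A2_cover_pq : A2_cover A2_p A2_q
  | A2_cover_qr : A2_cover A2_q A2_r
  | A2_cover_qs : A2_cover A2_q A2_s.

Lemma A2_leP x y : A2_le x y <-> clos_refl_trans A2 A2_cover x y.
Proof.
split; last first.
  elim=> {x y} [x y [] //|[] //|x y z _ xy _ yz].
  by case: x y z xy yz => [] [] [].
have pq := rt_step _ _ _ _ A2_cover_pq.
have qr := rt_step _ _ _ _ A2_cover_qr.
have qs := rt_step _ _ _ _ A2_cover_qs.
case: x y => [] [] //= _; try exact: rt_refl; try assumption.
- exact: rt_trans pq qr.
- exact: rt_trans pq qs.
Qed.

(* The only incomparable pair is r, s, whose meet is q. *)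
Definition A2_meet (x y : A2) : A2 :=
  if A2_le x y then x else if A2_le y x then y else A2_q.

(* This is the join of comparable elements only: r and s have no upper bound,
   and the value at (r, s) is junk. The three meets in A2_med are pairwise
   comparable, so A2_med never uses it. *)
Definition A2_join (x y : A2) : A2 := if A2_le x y then y else x.

Definition A2_med (x y z : A2) : A2 :=
  A2_join (A2_join (A2_meet x y) (A2_meet x z)) (A2_meet z y).

Lemma A2_meetP x y z : A2_le z (A2_meet x y) = A2_le z x && A2_le z y.
Proof. by case: x y z => [] [] []. Qed.

Lemma A2_medP x y z w :
  A2_le (A2_med x y z) w =
  [&& A2_le (A2_meet x y) w, A2_le (A2_meet x z) w & A2_le (A2_meet z y) w].
Proof. by case: x y z w => [] [] [] []. Qed.

Lemma A2_med_xx x y : A2_med x x y = x.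
Proof. by case: x y => [] []. Qed.

Lemma A2_med_swap12 x y z : A2_med x y z = A2_med y x z.
Proof. by case: x y z => [] [] []. Qed.

Lemma A2_med_swap23 x y z : A2_med y x z = A2_med y z x.
Proof. by case: x y z => [] [] []. Qed.

Lemma A2_med_distr x y z t u :
  A2_med (A2_med x y z) t u = A2_med x (A2_med y t u) (A2_med z t u).
Proof. by case: x y z t u => [] [] [] [] []. Qed.

Definition A2_alg : medianAlgebra :=
  MedianAlgebra A2_med_xx A2_med_swap12 A2_med_swap23 A2_med_distr.

Lemma A2_med_prs : A2_med A2_p A2_r A2_s = A2_q.
Proof. by []. Qed.

Lemma A2_leE x y : A2_le x y <-> leq_at (A2_p : A2_alg) x y.
Proof. by rewrite /leq_at; case: x y => [] []. Qed.

(* Main.v *)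
Require Import Defs.
From mathcomp Require Import all_boot.
From Stdlib Require Import Classical.

Set Implicit Arguments.
Unset Strict Implicit.
Unset Printing Implicit Defensive.

(** The three conditions are linked by a cycle of implications between their
    negations.

    If [w = med x y z] is none of [x], [y], [z], then [w] is a common value of
    [med x y w], [med x z w] and [med y z w] (absorption), so the four elements
    are closed under the median and their median table is that of A2, with [w]
    in the role of the branching point q ([med_gap_copy]). A copy of the algebra
    A2 is a copy of the poset A2 for the order based at the image of p, because
    that order is defined by the median ([subalgebra_copy_poset_copy]). Finally,
    in a copy of the poset A2 for the order based at [a], consider the meet
    [med a r s]. It is neither [r] nor [s], as these are incomparable; it is not [a]
    either, since it lies above [q], which lies strictly above [p] and hence is
    not the bottom element. So conservativity fails at [a], [r], [s]
    ([conservative_no_poset_copy]). *)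

Section MedianIdentities.

Variable A : medianAlgebra.
Implicit Types a x y z v : A.

Lemma med_rot x y z : med x y z = med y z x.
Proof. by rewrite med_swap12 med_swap23. Qed.

(** In this form, an equation on one median rewrites its six permutations. *)
Lemma med_permE x y z v : med x y z = v ->
  (med x y z = v) * (med x z y = v) * (med y x z = v) *
  (med y z x = v) * (med z x y = v) * (med z y x = v).
Proof.
move=> e; have yxz : med y x z = v by rewrite med_swap12.
by do !split=> //; [rewrite med_rot med_rot | rewrite -med_rot | rewrite med_rot
  | rewrite med_rot].
Qed.

Lemma med_majority x y :
  (med x x y = x) * (med x y x = x) * (med y x x = x).
Proof. by have e := med_permE (med_xx x y); do !split; rewrite e. Qed.

(** The left-hand side is [med (med z x y) x y]; distributing the outer
    [med _ x y] over [x] and [y] leaves both unchanged, by majority. *)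
Lemma med_absorb x y z : med x y (med x y z) = med x y z.
Proof. by rewrite -(med_rot z x y) -med_rot med_distr !med_majority. Qed.

Lemma leq_at_bot a x : leq_at a x a -> x = a.
Proof. by rewrite /leq_at med_majority. Qed.

(** The median [med a x y] is the meet of [x] and [y] for the order based at
    [a]; this is the half of that fact which makes it the greatest lower bound.
    It comes from distributing [med _ a z] over [med y x a]. *)
Lemma leq_at_meet a x y z :
  leq_at a z x -> leq_at a z y -> leq_at a z (med a x y).
Proof.
rewrite /leq_at => zx zy.
rewrite -med_rot (med_swap12 a x) -(med_rot y x a).
by rewrite med_distr (med_permE zx) med_majority (med_permE zy).
Qed.

End MedianIdentities.

Section Copies.

Variable A : medianAlgebra.
Implicit Types a x y z : A.

(** The elements are sent as p to [x], q to the median, r to [y], s to [z].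
    The choice of [x] for p is arbitrary, since the median of A2 treats p, r
    and s symmetrically. *)
Lemma med_gap_copy x y z :
  ~ [\/ med x y z = x, med x y z = y | med x y z = z] ->
  contains_subalgebra_copy A A2_alg.
Proof.
set w := med x y z => gap.
have wx : w <> x by move=> e; apply: gap; apply: Or31.
have wy : w <> y by move=> e; apply: gap; apply: Or32.
have wz : w <> z by move=> e; apply: gap; apply: Or33.
(* Two equal arguments would form a majority and give a median among them. *)
have xy : x <> y by move=> e; apply: wx; rewrite /w -e med_majority.
have xz : x <> z by move=> e; apply: wx; rewrite /w -e med_majority.
have yz : y <> z by move=> e; apply: wy; rewrite /w -e med_majority.
have xyz := med_permE (erefl w : med x y z = w).
have xyw := med_permE (med_absorb x y z : med x y w = w).
have xzw : med x z w = w by have := med_absorb x z y; rewrite !xyz.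
have yzw : med y z w = w by have := med_absorb y z x; rewrite !xyz.
pose f (u : A2_alg) : A :=
  match u with A2_p => x | A2_q => w | A2_r => y | A2_s => z end.
have f_med u v t : f (med u v t) = med (f u) (f v) (f t).
  by case: u; case: v; case: t; rewrite /= ?med_majority // ?xyz // ?xyw //
     ?(med_permE xzw) // ?(med_permE yzw).
exists (fun v => exists u, f u = v); split.
  by move=> _ _ _ [u <-] [v <-] [t <-]; exists (med u v t).
exists f; split=> //; case=> [] [] //= e; congruence.
Qed.

Lemma subalgebra_copy_poset_copy :
  contains_subalgebra_copy A A2_alg ->
  exists a : A, contains_poset_copy (leq_at a) (fun u v : A2 => A2_le u v).
Proof.
case=> S [_ [f [f_inj Sf f_med]]]; exists (f A2_p), S, f; split=> // u v.
rewrite A2_leE /leq_at -f_med; split=> [-> //|]; exact: f_inj.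
Qed.

(** The images of r and s have [a], possibly different from the image of p, as
    their base point, so the median to look at is the one with [a], which is
    their meet. *)
Lemma conservative_no_poset_copy a :
  conservative A ->
  ~ contains_poset_copy (leq_at a) (fun u v : A2 => A2_le u v).
Proof.
move=> cons [S [f [f_inj _ f_le]]].
have pq : leq_at a (f A2_p) (f A2_q) by apply/f_le.
have qr : leq_at a (f A2_q) (f A2_r) by apply/f_le.
have qs : leq_at a (f A2_q) (f A2_s) by apply/f_le.
case: (cons a (f A2_r) (f A2_s)) => e.
- have qa : f A2_q = a.
    by apply: leq_at_bot; have := leq_at_meet qr qs; rewrite e.
  have pa : f A2_p = a by apply: leq_at_bot; rewrite -{2}qa.
  by have := f_inj A2_p A2_q (etrans pa (esym qa)).
- by have /f_le := e : leq_at a (f A2_r) (f A2_s).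
- have sr : leq_at a (f A2_s) (f A2_r) by rewrite /leq_at (med_permE e).
  by move/f_le: sr.
Qed.

Lemma no_subalgebra_copy_conservative :
  ~ contains_subalgebra_copy A A2_alg -> conservative A.
Proof.
by move=> no_copy x y z; apply: NNPP => gap; apply/no_copy/(med_gap_copy gap).
Qed.

End Copies.

Theorem theorem2 (A : medianAlgebra) :
  (conservative A <-> ~ contains_subalgebra_copy A A2_alg) /\
  (conservative A <->
     forall a : A, ~ contains_poset_copy (leq_at a) (fun x y : A2 => A2_le x y)).
Proof.
split; split.
- move=> cons /subalgebra_copy_poset_copy [a].
  exact: conservative_no_poset_copy.
- exact: no_subalgebra_copy_conservative.
- by move=> cons a; apply: conservative_no_poset_copy.
- move=> no_poset; apply: no_subalgebra_copy_conservative.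
  by case/subalgebra_copy_poset_copy=> a /no_poset.
Qed.
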